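(* The following two statements are equivalent. (A) (Log-rank conjecture) There is a constant $C$ such that every function $f:\mathcal X\times\mathcal Y\to\{0,1\}$ (finite $\mathcal X,\mathcal Y$) with $\operatorname{rank}(f)\ge 2$ satisfies $\operatorname{CC}_{det}(f)\le C(\log\operatorname{rank}(f))^C$. (B) There is a constant $C$ such that for every $d\ge 2$ and every configuration $(\mathcal P,\mathcal H)$ in $\mathbb R^d$ with $n=|\mathcal P|$ points and $m=|\mathcal H|$ hyperplanes that admits a parallel $2$-partition and has offset set $\mathcal B(\mathcal H)=\{0,1\}$, we have $\operatorname{rs}(\mathcal P,\mathcal H)\ge mn\cdot 2^{-C(\log d)^C}$.
   Context: $\operatorname{CC}_{det}(f)$ is the deterministic two-party communication complexity of $f$ (minimum over protocols computing $f(x,y)$, Alice holding $x$ and Bob $y$, of the worst-case number of bits communicated); $\operatorname{rank}(f)$ is the real rank of the matrix $(f(x,y))_{x,y}$. Logarithms are base 2. A configuration is a finite set $\mathcal P$ of points and a finite set $\mathcal H$ of hyperplanes in $\mathbb R^d$; each hyperplane is written $\{x:\langle a,x\rangle=b\}$ with $a\ne0$, $b$ its offset, and $\mathcal B(\mathcal H)=\{b(h):h\in\mathcal H\}$. A parallel $k$-partition is a partition of $\mathcal H$ into blocks of size at most $k$ such that all hyperplanes in a block share the same normal vector and every point of $\mathcal P$ lies on some hyperplane of each block. $\operatorname{rs}(\mathcal P,\mathcal H)=\max_{S}\,|\{p\in\mathcal P: p\in S\}|\cdot|\{h\in\mathcal H: S\subseteq h\}|$ over affine subspaces $S\subseteq\mathbb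 R^d$. *)

(* Defs.v *)
From HB Require Import structures.
From mathcomp Require Import all_boot all_order all_algebra.
From mathcomp Require Import boolp classical_sets reals exp.
Set Implicit Arguments. Unset Strict Implicit. Unset Printing Implicit Defensive.
Import Order.TTheory GRing.Theory Num.Theory.
Local Open Scope ring_scope.

Inductive protocol (X Y : Type) : Type :=
| PLeaf : bool -> protocol X Y
| PAlice : (X -> bool) -> protocol X Y -> protocol X Y -> protocol X Y
| PBob : (Y -> bool) -> protocol X Y -> protocol X Y -> protocol X Y.

Fixpoint peval (X Y : Type) (t : protocol X Y) (x : X) (y : Y) : bool :=
  match t with
  | PLeaf b => b
  | PAlice g t0 t1 => if g x then peval t1 x y else peval t0 x y
  | PBob h t0 t1 => if h y then peval t1 x y else peval t0 x y
  end.

Fixpoint pdepth (X Y : Type) (t : protocol X Y) : nat :=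
  match t with
  | PLeaf _ => 0
  | PAlice _ t0 t1 => (maxn (pdepth t0) (pdepth t1)).+1
  | PBob _ t0 t1 => (maxn (pdepth t0) (pdepth t1)).+1
  end.

Definition computes (X Y : Type) (f : X -> Y -> bool) (t : protocol X Y) :=
  forall x y, peval t x y = f x y.

Fixpoint alice_id (X Y : eqType) (s : seq X) (k : X -> protocol X Y) : protocol X Y :=
  match s with
  | [::] => PLeaf X Y false
  | a :: s' => PAlice (fun x => x == a) (@alice_id X Y s' k) (k a)
  end.

Fixpoint bob_id (X Y : eqType) (s : seq Y) (k : Y -> protocol X Y) : protocol X Y :=
  match s with
  | [::] => PLeaf X Y false
  | a :: s' => PBob (fun y => y == a) (@bob_id X Y s' k) (k a)
  end.

Lemma alice_idE (X Y : eqType) (s : seq X) (k : X -> protocol X Y) x y :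
  x \in s -> peval (alice_id s k) x y = peval (k x) x y.
Proof.
elim: s => [//|a s IH] /=; rewrite in_cons.
by case: eqVneq => [-> //|_ /= /IH].
Qed.

Lemma bob_idE (X Y : eqType) (s : seq Y) (k : Y -> protocol X Y) x y :
  y \in s -> peval (bob_id s k) x y = peval (k y) x y.
Proof.
elim: s => [//|a s IH] /=; rewrite in_cons.
by case: eqVneq => [-> //|_ /= /IH].
Qed.

Lemma protocol_exists (X Y : finType) (f : X -> Y -> bool) :
  exists c, `[< exists t : protocol X Y, computes f t /\ (pdepth t <= c)%N >].
Proof.
exists (pdepth (alice_id (enum X) (fun a => bob_id (enum Y) (fun b => PLeaf X Y (f a b))))).
apply/asboolP; eexists; split; last exact: leqnn.
by move=> x y; rewrite alice_idE ?mem_enum // bob_idE ?mem_enum.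
Qed.

Definition CCdet (X Y : finType) (f : X -> Y -> bool) : nat :=
  ex_minn (protocol_exists f).

Definition frank (R : realType) (X Y : finType) (f : X -> Y -> bool) : nat :=
  \rank (\matrix_(i < #|X|, j < #|Y|) ((f (enum_val i) (enum_val j) : nat)%:R : R)).

Definition log2 (R : realType) (x : R) : R := ln x / ln 2.

Definition dotp (R : realType) (d : nat) (a x : 'rV[R]_d) : R :=
  \sum_(i < d) a ord0 i * x ord0 i.

(* A hyperplane {x : <a,x> = b} is given by the pair (a, b). *)
Definition hyp (R : realType) (d : nat) := ('rV[R]_d * R)%type.

Definition on_hyp (R : realType) (d : nat) (h : hyp R d) (x : 'rV[R]_d) : Prop :=
  dotp h.1 x = h.2.

Definition hyp_set (R : realType) (d : nat) (h : hyp R d) : set 'rV[R]_d :=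
  [set x | on_hyp h x].

Definition configuration (R : realType) (d : nat)
    (P : seq 'rV[R]_d) (H : seq (hyp R d)) : Prop :=
  [/\ uniq P, uniq H,
      (forall h, h \in H -> h.1 != 0) &
      (forall h1 h2, h1 \in H -> h2 \in H -> hyp_set h1 = hyp_set h2 -> h1 = h2)].

Definition offsets_are (R : realType) (d : nat) (H : seq (hyp R d)) (B : set R) : Prop :=
  forall b, b \in [seq h.2 | h <- H] <-> B b.

Definition parallel_partition (R : realType) (d : nat) (k : nat)
    (P : seq 'rV[R]_d) (H : seq (hyp R d)) (Q : seq (seq (hyp R d))) : Prop :=
  perm_eq (flatten Q) H /\
  forall blk, blk \in Q ->
    [/\ blk != [::], (size blk <= k)%N,
        (forall h1 h2, h1 \in blk -> h2 \in blk -> h1.1 = h2.1) &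
        (forall p, p \in P -> exists2 h, h \in blk & on_hyp h p)].

Definition has_parallel_partition (R : realType) (d : nat) (k : nat)
    (P : seq 'rV[R]_d) (H : seq (hyp R d)) : Prop :=
  exists Q, parallel_partition k P H Q.

Definition in_aff (R : realType) (d : nat) (x0 : 'rV[R]_d) (V : {vspace 'rV[R]_d})
    (p : 'rV[R]_d) : bool := (p - x0) \in V.

Definition aff_sub_hyp (R : realType) (d : nat) (x0 : 'rV[R]_d) (V : {vspace 'rV[R]_d})
    (h : hyp R d) : Prop := forall y, in_aff x0 V y -> on_hyp h y.

Definition rs_value (R : realType) (d : nat) (P : seq 'rV[R]_d) (H : seq (hyp R d))
    (x0 : 'rV[R]_d) (V : {vspace 'rV[R]_d}) : nat :=
  count (in_aff x0 V) P * count (fun h => `[< aff_sub_hyp x0 V h >]) H.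

Definition rs_pred (R : realType) (d : nat) (P : seq 'rV[R]_d) (H : seq (hyp R d))
  : pred nat := fun k => `[< exists x0 V, rs_value P H x0 V = k >].

Lemma rs_pred_ex (R : realType) (d : nat) (P : seq 'rV[R]_d) (H : seq (hyp R d)) :
  exists k, rs_pred P H k.
Proof. by exists (rs_value P H 0 0%VS); apply/asboolP; exists 0, 0%VS. Qed.

Lemma rs_pred_bound (R : realType) (d : nat) (P : seq 'rV[R]_d) (H : seq (hyp R d)) :
  forall k, rs_pred P H k -> (k <= size P * size H)%N.
Proof.
move=> k /asboolP [x0 [V <-]]; rewrite /rs_value.
by apply: leq_mul; apply: count_size.
Qed.

Definition rs (R : realType) (d : nat) (P : seq 'rV[R]_d) (H : seq (hyp R d)) : nat :=
  ex_maxn (@rs_pred_ex R d P H) (@rs_pred_bound R d P H).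

(* Main.v *)
Require Import Defs.
From HB Require Import structures.
From mathcomp Require Import all_boot all_order all_algebra.
From mathcomp Require Import boolp classical_sets reals exp.
From mathcomp Require Import zify ring lra.
Import Order.TTheory GRing.Theory Num.Theory.
Local Open Scope ring_scope.

(** (A) => (B): a configuration in R^d with offsets 0 and 1 is the same thing as
    a 0/1 matrix (points against blocks) of rank at most d.  A protocol of cost c
    has a monochromatic rectangle of density 2^-c, and the affine hull of its
    points lies in one hyperplane of each of its blocks.

    (B) => (A): a rank factorization turns a 0/1 matrix into such a
    configuration, so every 0/1 matrix of rank r has a monochromatic rectangle of
    density 2^-polylog(r).  As in Nisan and Wigderson, the row strip or the column
    strip of this rectangle has rank about r/2; instead of following one rectangle
    at a time (which needs a balancing of the protocol tree), strips of rank r/2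
    are removed until nothing is left, the parties announce when their input was
    removed, and they recurse on a strip containing the input. *)

Set Implicit Arguments.
Unset Strict Implicit.

(** * Rank factorizations on subrectangles *)

(** Coordinates are indexed by [nat] rather than ['I_r], so that the rank bound can change without
    casts. *)
Definition low_rank (F : fieldType) (X Y : finType) (g : X -> Y -> F) (r : nat)
    (A : {set X}) (B : {set Y}) : Prop :=
  exists (u : X -> nat -> F) (v : Y -> nat -> F),
    {in A & B, forall x y, g x y = \sum_(i < r) u x i * v y i}.

Lemma low_rank_mxP (F : fieldType) (X Y : finType) (g : X -> Y -> F) r
    (A : {set X}) (B : {set Y}) :
  low_rank g r A B <->
  exists (u : X -> 'rV[F]_r) (v : Y -> 'cV[F]_r),
    {in A & B, forall x y, g x y = (u x *m v y) 0 0}.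
Proof.
split=> [[u [v uv]]|[u [v uv]]].
  exists (fun x => \row_i u x i), (fun y => \col_i v y i) => x y xA yB.
  by rewrite uv // mxE; apply: eq_bigr => i _; rewrite !mxE.
pose ext (w : 'I_r -> F) j := if insub j is Some i then w i else 0.
exists (fun x => ext (u x 0)), (fun y => ext ((v y)^~ 0)) => x y xA yB.
by rewrite uv // mxE; apply: eq_bigr => i _; rewrite /ext valK.
Qed.

Lemma low_rankS (F : fieldType) (X Y : finType) (g : X -> Y -> F) r
    (A A' : {set X}) (B B' : {set Y}) :
  A' \subset A -> B' \subset B -> low_rank g r A B -> low_rank g r A' B'.
Proof.
move=> /fintype.subsetP sA /fintype.subsetP sB [u [v uv]]; exists u, v => x y xA yB.
by apply: uv; [apply: sA | apply: sB].
Qed.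

Lemma low_rank_widen (F : fieldType) (X Y : finType) (g : X -> Y -> F) r s
    (A : {set X}) (B : {set Y}) :
  (r <= s)%N -> low_rank g r A B -> low_rank g s A B.
Proof.
move=> rs [u [v uv]]; exists (fun x i => if (i < r)%N then u x i else 0), v.
move=> x y xA yB; rewrite uv // (big_ord_widen s (fun i => u x i * v y i) rs).
by rewrite big_mkcond /=; apply: eq_bigr => i _; case: ifP; rewrite ?mul0r.
Qed.

Lemma low_rank_tr (F : fieldType) (X Y : finType) (g : X -> Y -> F) r
    (A : {set X}) (B : {set Y}) :
  low_rank g r A B -> low_rank (fun y x => g x y) r B A.
Proof.
move=> [u [v uv]]; exists v, u => y x yB xA.
by rewrite uv //; apply: eq_bigr => i _; rewrite mulrC.
Qed.

Lemma low_rank_addc (F : fieldType) (X Y : finType) (g h : X -> Y -> F) c r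
    (A : {set X}) (B : {set Y}) :
  {in A & B, forall x y, h x y = g x y + c} ->
  low_rank g r A B -> low_rank h r.+1 A B.
Proof.
move=> hg [u [v uv]].
exists (fun x i => if (i < r)%N then u x i else 1).
exists (fun y i => if (i < r)%N then v y i else c) => x y xA yB.
rewrite hg // uv // big_ord_recr /= ltnn mul1r; congr (_ + _).
by apply: eq_bigr => i _; rewrite ltn_ord.
Qed.

Definition row_span (F : fieldType) (X : finType) r (u : X -> 'rV[F]_r)
    (A : {set X}) : 'M[F]_(#|A|, r) := \matrix_(i < #|A|) u (enum_val i).

Lemma sub_row_span (F : fieldType) (X : finType) r (u : X -> 'rV[F]_r)
    (A : {set X}) x : x \in A -> (u x <= row_span u A)%MS.
Proof.
move=> xA; have -> : u x = row (enum_rank_in xA x) (row_span u A).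
  by rewrite rowK enum_rankK_in.
exact: row_sub.
Qed.

(** Each [u x] is rewritten in a basis of the span over [A], and the basis is absorbed into [v]. *)
Lemma low_rank_row_span (F : fieldType) (X Y : finType) (g : X -> Y -> F) r
    (u : X -> 'rV[F]_r) (v : Y -> 'cV[F]_r) (A : {set X}) (B : {set Y}) :
  {in A & B, forall x y, g x y = (u x *m v y) 0 0} ->
  low_rank g (\rank (row_span u A)) A B.
Proof.
move=> uv; apply/low_rank_mxP; set U := row_span u A.
exists (fun x => u x *m pinvmx (row_base U)), (fun y => row_base U *m v y).
move=> x y xA yB; rewrite uv // mulmxA mulmxKpV //.
by rewrite eq_row_base sub_row_span.
Qed.

(** A zero block makes the row vectors over [A'] orthogonal to the column vectors over [B'], so the
    dimensions of the two spans add up to at most [r]. Each strip factors through its own span. *)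
Lemma low_rank_orth (F : fieldType) (X Y : finType) (g : X -> Y -> F) r
    (A A' : {set X}) (B B' : {set Y}) :
  A' \subset A -> B' \subset B -> low_rank g r A B ->
  {in A' & B', forall x y, g x y = 0} ->
  exists s t, [/\ (s + t <= r)%N, low_rank g s A' B & low_rank g t A B'].
Proof.
move=> /fintype.subsetP sA /fintype.subsetP sB /low_rank_mxP [u [v uv]] g0.
exists (\rank (row_span u A')), (\rank (row_span (fun y => (v y)^T) B')); split.
- rewrite -(mxrank_tr (row_span _ B')); apply: mulmx0_rank_max.
  apply/matrixP => i j; rewrite [RHS]mxE.
  rewrite -(g0 (enum_val i) (enum_val j)) ?enum_valP // uv ?sA ?sB ?enum_valP //.
  by rewrite !mxE; apply: eq_bigr => k _; rewrite !mxE.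
- by apply: low_rank_row_span => x y xA yB; apply: uv => //; apply: sA.
- apply/low_rank_tr/(low_rank_row_span (v := fun x => (u x)^T)) => y x yB xA.
  by rewrite -trmx_mul mxE uv // sB.
Qed.

(* Subtracting the constant raises the rank by at most one and turns the
   monochromatic rectangle into a zero block, whose row and column strips have
   ranks adding up to at most r + 1; putting the constant back costs one more. *)
Lemma low_rank_halve (F : fieldType) (X Y : finType) (g : X -> Y -> F) c r
    (A A' : {set X}) (B B' : {set Y}) :
  A' \subset A -> B' \subset B -> low_rank g r A B ->
  {in A' & B', forall x y, g x y = c} ->
  low_rank g (r + 3)./2 A' B \/ low_rank g (r + 3)./2 A B'.
Proof.
move=> sA sB lg gc; pose h x y := g x y - c.
have lh : low_rank h r.+1 A B by apply: (@low_rank_addc _ _ _ g _ (- c)).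
have h0 : {in A' & B', forall x y, h x y = 0}.
  by move=> x y xA yB; rewrite /h gc // subrr.
have [s [t [st ls lt]]] := low_rank_orth sA sB lh h0.
have gh x y : g x y = h x y + c by rewrite /h subrK.
have [le_st|lt_ts] := leqP s t; [left|right].
  by apply: low_rank_widen (low_rank_addc (fun x y _ _ => gh x y) ls); lia.
by apply: low_rank_widen (low_rank_addc (fun x y _ _ => gh x y) lt); lia.
Qed.

(** * Distinct rows of a 0/1 matrix of bounded rank *)

Definition bool_fun (F : fieldType) (X Y : Type) (f : X -> Y -> bool) : X -> Y -> F :=
  fun x y => (f x y : nat)%:R.
Arguments bool_fun F {X Y} f.

Lemma bool_fun_inj (F : fieldType) (a b : bool) :
  (a : nat)%:R = (b : nat)%:R :> F -> a = b.
Proof.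
by case: a b => [] [] //= /eqP; rewrite ?oner_eq0 // eq_sym oner_eq0.
Qed.

(** Some [\rank V] of the vectors [v y] span all those over [B], so the bits of a row at these
    columns determine the whole row on [B]. *)
Lemma low_rank_code (F : fieldType) (X Y : finType) (f : X -> Y -> bool) r
    (A : {set X}) (B : {set Y}) :
  low_rank (bool_fun F f) r A B ->
  exists s (code : X -> {ffun 'I_s -> bool}), (s <= r)%N /\
    {in A &, forall x x', code x = code x' -> {in B, f x =1 f x'}}.
Proof.
move=> /low_rank_mxP [u [v uv]]; set V := row_span (fun y => (v y)^T) B.
exists (\rank V), (fun x => [ffun i => f x (enum_val (maxrankfun V i))]).
split=> [|x x' xA x'A /ffunP cc y yB]; first exact: rank_leq_col.
have /submxP [D vD] : ((v y)^T <= rowsub (maxrankfun V) V)%MS.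
  by rewrite eq_maxrowsub (sub_row_span (fun y => (v y)^T)).
have {}vD : v y = (rowsub (maxrankfun V) V)^T *m D^T by rewrite -trmx_mul -vD trmxK.
apply: (@bool_fun_inj F); rewrite -!/(bool_fun F f _ _) !uv // vD !mulmxA.
congr ((_ *m _) _ _); apply/rowP => i.
have uE z : z \in A ->
    (u z *m (rowsub (maxrankfun V) V)^T) 0 i = bool_fun F f z (enum_val (maxrankfun V i)).
  move=> zA; rewrite uv ?enum_valP // !mxE.
  by apply: eq_bigr => k _; rewrite !mxE.
by rewrite !uE // /bool_fun; move: (cc i); rewrite !ffunE => ->.
Qed.

Lemma low_rank_repr (F : fieldType) (X Y : finType) (f : X -> Y -> bool) r
    (A : {set X}) (B : {set Y}) :
  low_rank (bool_fun F f) r A B ->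
  exists (A0 : {set X}) (rho : X -> X), (#|A0| <= 2 ^ r)%N /\
    {in A, forall x, rho x \in A0 /\ {in B, f (rho x) =1 f x}}.
Proof.
move=> /low_rank_code [s [code [sr codeP]]].
pose rho x := odflt x [pick x' in A | code x' == code x].
have rhoP x : x \in A -> rho x \in A /\ code (rho x) = code x.
  rewrite /rho => xA; case: pickP => [x' /andP [x'A /eqP] //|/(_ x)].
  by rewrite xA eqxx.
exists (rho @: A), rho; split; last first.
  move=> x xA; split; first exact: imset_f.
  by have [rA rE] := rhoP _ xA; apply: codeP.
have code_inj : {in rho @: A &, injective code}.
  move=> _ _ /imsetP [x xA ->] /imsetP [x' x'A ->].
  rewrite (rhoP _ xA).2 (rhoP _ x'A).2 => cc.
  (* Equal codes make both picks search with the same predicate; the search succeeds, so the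
     defaults [x] and [x'] are not reached. *)
  rewrite /rho cc; case: pickP => // /(_ x').
  by rewrite x'A eqxx.
rewrite -(card_in_imset code_inj) (leq_trans (max_card _)) //.
by rewrite card_ffun card_bool card_ord leq_exp2l.
Qed.

Lemma low_rank_frank (R : realType) (X Y : finType) (f : X -> Y -> bool) :
  low_rank (bool_fun R f) (frank R f) [set: X] [set: Y].
Proof.
apply/low_rank_mxP; rewrite /frank; set M := \matrix_(i, j) _.
exists (fun x => row (enum_rank x) (col_base M)).
exists (fun y => col (enum_rank y) (row_base M)) => x y _ _.
transitivity (M (enum_rank x) (enum_rank y)); first by rewrite mxE !enum_rankK.
rewrite -[M in LHS]mulmx_base !mxE; apply: eq_bigr => k _.
by rewrite !mxE.
Qed.

Lemma frank_le (R : realType) (X Y : finType) (f : X -> Y -> bool) r :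
  low_rank (bool_fun R f) r [set: X] [set: Y] -> (frank R f <= r)%N.
Proof.
move=> /low_rank_mxP [u [v uv]]; rewrite /frank; set M := \matrix_(i, j) _.
have -> : M = (\matrix_(i < #|X|) u (enum_val i)) *m
              (\matrix_(j < #|Y|) (v (enum_val j))^T)^T.
  apply/matrixP => i j; rewrite mxE -/(bool_fun R f _ _) uv ?inE // !mxE.
  by apply: eq_bigr => k _; rewrite !mxE.
exact: leq_trans (mxrankM_maxl _ _) (rank_leq_col _).
Qed.

(** * Protocols on subrectangles *)

Definition cc_le (X Y : finType) (f : X -> Y -> bool) (A : {set X}) (B : {set Y})
    (c : nat) : Prop :=
  exists t : protocol X Y, (pdepth t <= c)%N /\ {in A & B, forall x y, peval t x y = f x y}.

Lemma CCdet_le (X Y : finType) (f : X -> Y -> bool) c :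
  cc_le f [set: X] [set: Y] c -> (CCdet f <= c)%N.
Proof.
move=> [t [tc tf]]; rewrite /CCdet; case: ex_minnP => m _; apply.
by apply/asboolP; exists t; split => // x y; apply: tf; rewrite inE.
Qed.

Lemma CCdet_protocol (X Y : finType) (f : X -> Y -> bool) :
  exists t : protocol X Y, computes f t /\ (pdepth t <= CCdet f)%N.
Proof. by rewrite /CCdet; case: ex_minnP => m /asboolP. Qed.

Lemma protocol_comap (X X' Y Y' : Type) (t : protocol X' Y') (rho : X -> X') (sigma : Y -> Y') :
  exists t' : protocol X Y, pdepth t' = pdepth t /\
    forall x y, peval t' x y = peval t (rho x) (sigma y).
Proof.
elim: t => [b|g t0 [t0' [d0 e0]] t1 [t1' [d1 e1]]|g t0 [t0' [d0 e0]] t1 [t1' [d1 e1]]].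
- by exists (PLeaf X Y b).
- exists (PAlice (g \o rho) t0' t1'); split=> [|x y] /=; first by rewrite d0 d1.
  by rewrite e0 e1.
- exists (PBob (g \o sigma) t0' t1'); split=> [|x y] /=; first by rewrite d0 d1.
  by rewrite e0 e1.
Qed.

Lemma cc_le_repr (X Y : finType) (f : X -> Y -> bool) (A A0 : {set X}) (B B0 : {set Y})
    (rho : X -> X) (sigma : Y -> Y) c :
  {in A, forall x, rho x \in A0} -> {in B, forall y, sigma y \in B0} ->
  {in A & B, forall x y, f (rho x) (sigma y) = f x y} ->
  cc_le f A0 B0 c -> cc_le f A B c.
Proof.
move=> rA sB fE [t [tc tf]].
have [t' [dt' et']] := protocol_comap t rho sigma.
exists t'; split=> [|x y xA yB]; first by rewrite dt'.
by rewrite et' tf ?fE ?rA ?sB.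
Qed.

(** Alice announces [g x] in [c] bits, lowest bit first; each bit restricts the family [T] to the
    indices of that parity. *)
Lemma send_alice (X Y : Type) (D c : nat) (g : X -> nat) (T : nat -> protocol X Y) :
  (forall i, (pdepth (T i) <= D)%N) ->
  exists t : protocol X Y, (pdepth t <= c + D)%N /\
    forall x y, (g x < 2 ^ c)%N -> peval t x y = peval (T (g x)) x y.
Proof.
elim: c g T => [|c IH] g T TD.
  exists (T 0%N); split=> [|x y]; first exact: TD.
  by rewrite expn0 ltnS leqn0 => /eqP ->.
have [|t0 [d0 e0]] := IH (fun x => (g x)./2) (fun i => T i.*2); first by [].
have [|t1 [d1 e1]] := IH (fun x => (g x)./2) (fun i => T i.*2.+1); first by [].
exists (PAlice (fun x => odd (g x)) t0 t1); split=> [|x y gx] /=.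
  by rewrite addSn ltnS geq_max d0.
have gx2 : ((g x)./2 < 2 ^ c)%N by move: gx; rewrite expnS; lia.
rewrite e0 // e1 // -[in RHS](odd_double_half (g x)).
by case: (odd _).
Qed.

Lemma send_bob (X Y : Type) (D c : nat) (g : Y -> nat) (T : nat -> protocol X Y) :
  (forall i, (pdepth (T i) <= D)%N) ->
  exists t : protocol X Y, (pdepth t <= c + D)%N /\
    forall x y, (g y < 2 ^ c)%N -> peval t x y = peval (T (g y)) x y.
Proof.
elim: c g T => [|c IH] g T TD.
  exists (T 0%N); split=> [|x y]; first exact: TD.
  by rewrite expn0 ltnS leqn0 => /eqP ->.
have [|t0 [d0 e0]] := IH (fun x => (g x)./2) (fun i => T i.*2); first by [].
have [|t1 [d1 e1]] := IH (fun x => (g x)./2) (fun i => T i.*2.+1); first by [].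
exists (PBob (fun x => odd (g x)) t0 t1); split=> [|x y gx] /=.
  by rewrite addSn ltnS geq_max d0.
have gx2 : ((g y)./2 < 2 ^ c)%N by move: gx; rewrite expnS; lia.
rewrite e0 // e1 // -[in RHS](odd_double_half (g y)).
by case: (odd _).
Qed.

(** Alice sends the position of her row's representative in [r] bits, and Bob answers with the
    value. *)
Lemma cc_le_low_rank (F : fieldType) (X Y : finType) (f : X -> Y -> bool) r
    (A : {set X}) (B : {set Y}) :
  low_rank (bool_fun F f) r A B -> cc_le f A B r.+1.
Proof.
move=> /low_rank_repr [A0 [rho [cA0 rhoP]]].
pose x0 i x := nth x (enum A0) i.
(* Reading the [i]-th entry by [ohead (drop i _)] needs no default element of [X], which may be
   empty. *)
pose T i : protocol X Y :=
  if ohead (drop i (enum A0)) is Some x then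
    PBob (fun y => f x y) (PLeaf X Y false) (PLeaf X Y true) else PLeaf X Y false.
have TD i : (pdepth (T i) <= 1)%N by rewrite /T; case: ohead.
have [t [tD tP]] := send_alice r (fun x => index (rho x) (enum A0)) TD.
exists t; split=> [|x y xA yB]; first by rewrite -addn1.
have [rA rE] := rhoP x xA.
have lt_ind : (index (rho x) (enum A0) < size (enum A0))%N.
  by rewrite index_mem mem_enum.
rewrite tP; last by rewrite (leq_trans lt_ind) // -cardE.
rewrite /T (drop_nth x lt_ind) /= nth_index ?mem_enum // -rE //.
by case: (f _ _).
Qed.

(** * Halving the rank by removing strips *)

(** This is (1 - 1/q)^q <= 1/2 for q = p + 1, cleared of denominators. *)
Lemma expn_le_half p : (2 * p ^ p.+1 <= p.+1 ^ p.+1)%N.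
Proof.
(* Bernoulli's inequality for (1 + 1/p)^n, multiplied out; it is applied at n = p + 1. *)
have bern n : (p ^ n * (p + n) <= p * p.+1 ^ n)%N.
  elim: n => [|n IH]; first by rewrite !expn0; lia.
  have := leq_mul IH (leqnn p.+1); rewrite !expnS; nia.
case: p bern => [//|p] /(_ p.+2) bern.
rewrite -(leq_pmul2l (ltn0Sn p)) (leq_trans _ bern) //.
by rewrite mulnA [X in (_ <= X)%N]mulnC leq_mul2r; lia.
Qed.

(** A size below [2 ^ m], shrunk [q * m] times by the factor 1 - 1/q, drops below 1. *)
Lemma expn_pred_lt N m q : (0 < q)%N -> (N < 2 ^ m)%N ->
  (N * q.-1 ^ (q * m) < q ^ (q * m))%N.
Proof.
case: q => [//|p] _ Nm /=.
have [p0|p_gt0] := posnP (p ^ (p.+1 * m)).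
  by rewrite p0 muln0 expn_gt0.
have : (2 ^ m * p ^ (p.+1 * m) <= p.+1 ^ (p.+1 * m))%N.
  by rewrite !expnM -expnMn; case: (m) => [|k] //; rewrite leq_exp2r ?expn_le_half.
by apply: leq_trans; rewrite ltn_pmul2r.
Qed.

(** The matrix form of (B), with density 2^-e. Quantifying over all subrectangles lets it survive
    the recursion. *)
Definition rank_density (F : fieldType) (X Y : finType) (f : X -> Y -> bool) (r e : nat) :=
  forall (A : {set X}) (B : {set Y}), low_rank (bool_fun F f) r A B ->
  exists (A' : {set X}) (B' : {set Y}) (b : bool),
    [/\ A' \subset A, B' \subset B, {in A' & B', forall x y, f x y = b} &
        (#|A| * #|B| <= 2 ^ e * (#|A'| * #|B'|))%N].
Arguments rank_density F {X Y} f r e.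

(** A rectangle of density 1/q meets at least a fraction 1/q of the rows, so removing its rows
    leaves at most the fraction 1 - 1/q. *)
Lemma card_setD_peel (X Y : finType) (A A' : {set X}) (m m' q : nat) :
  A' \subset A -> (m' <= m)%N -> (0 < q)%N -> (#|A| * m <= q * (#|A'| * m'))%N ->
  (#|A :\: A'| * m * q <= #|A| * m * q.-1)%N.
Proof.
move=> sA m'm q0 dens; rewrite cardsD (finset.setIidPr sA).
have := subset_leq_card sA; move: #|A| #|A'| dens => a a' dens a'a.
have : (a' * m' <= a' * m)%N by rewrite leq_mul2l m'm orbT.
case: q q0 dens => // q _ dens le_m /=; nia.
Qed.

(* Repeatedly removing the rows or the columns of a monochromatic rectangle whose
   strip has small rank exhausts the matrix in k steps.  Each party alone knows
   at which step its input is removed, and the two answers together determine a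
   strip of small rank containing the input. *)
Lemma peel (F : fieldType) (X Y : finType) (f : X -> Y -> bool) r e N D :
  rank_density F f r e ->
  (forall (A : {set X}) (B : {set Y}), low_rank (bool_fun F f) (r + 3)./2 A B ->
     (#|A| * #|B| < N)%N -> cc_le f A B D) ->
  forall k (A : {set X}) (B : {set Y}), low_rank (bool_fun F f) r A B ->
  (#|A| * #|B| < N)%N ->
  (#|A| * #|B| * (2 ^ e).-1 ^ k < (2 ^ e) ^ k)%N ->
  exists (a : X -> nat) (b : Y -> nat) (T : nat -> nat -> protocol X Y),
    [/\ forall x, (a x <= k)%N, forall y, (b y <= k)%N,
        forall i j, (pdepth (T i j) <= D)%N &
        {in A & B, forall x y, peval (T (a x) (b y)) x y = f x y}].
Proof.
move=> dens small; elim=> [|k IH] A B lf ABN meas.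
  exists (fun=> 0%N), (fun=> 0%N), (fun _ _ => PLeaf X Y false); split=> // x y xA yB.
  (* For [k = 0] the measure bound says that the rectangle is empty. *)
  move: meas; rewrite !expn0 muln1 ltnS leqn0 muln_eq0 !cards_eq0.
  by case/orP=> /eqP E; [move: xA|move: yB]; rewrite E inE.
have [A' [B' [c [sA sB fc cardAB]]]] := dens A B lf.
have q0 : (0 < 2 ^ e)%N by rewrite expn_gt0.
have gc : {in A' & B', forall x y, bool_fun F f x y = (c : nat)%:R}.
  by move=> x y xA yB; rewrite /bool_fun fc.
have step M : (M * 2 ^ e <= #|A| * #|B| * (2 ^ e).-1)%N ->
    (M * (2 ^ e).-1 ^ k < (2 ^ e) ^ k)%N.
  move=> le_M; rewrite -(ltn_pmul2r q0) -expnSr mulnAC.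
  by apply: leq_ltn_trans meas; rewrite expnS mulnA leq_mul2r le_M orbT.
have [lA|lB] := low_rank_halve sA sB lf gc.
- have [|t [tD tf]] := small _ _ lA.
    by apply: leq_ltn_trans ABN; rewrite leq_mul2r subset_leq_card ?orbT.
  have [|||a [b [T [ak bk TD Tf]]]] := IH (A :\: A') B.
  + exact: low_rankS (finset.subsetDl _ _) (subxx _) lf.
  + apply: leq_ltn_trans ABN; rewrite leq_mul2r subset_leq_card ?orbT //.
    exact: finset.subsetDl.
  + by apply: step; apply: (@card_setD_peel X Y _ _ _ #|B'|); rewrite ?subset_leq_card.
  (* Alice's index 0 means that [x] lies in the strip removed now, where [t] is run whatever Bob's
     index is; her other indices are shifted by one, while Bob's stay. *)
  exists (fun x => if x \in A' then 0%N else (a x).+1), b.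
  exists (fun i j => if i is i'.+1 then T i' j else t); split.
  + by move=> x; case: ifP => //; rewrite ltnS ak.
  + by move=> y; apply: leq_trans (bk y) _.
  + by case.
  + move=> x y xA yB; case: ifPn => xA'; first exact: tf.
    by apply: Tf => //; rewrite inE xA'.
- have [|t [tD tf]] := small _ _ lB.
    by apply: leq_ltn_trans ABN; rewrite leq_mul2l subset_leq_card ?orbT.
  have [|||a [b [T [ak bk TD Tf]]]] := IH A (B :\: B').
  + exact: low_rankS (subxx _) (finset.subsetDl _ _) lf.
  + apply: leq_ltn_trans ABN; rewrite leq_mul2l subset_leq_card ?orbT //.
    exact: finset.subsetDl.
  + apply: step; rewrite ![(#|A| * _)%N]mulnC.
    apply: (@card_setD_peel Y X _ _ _ #|A'|); rewrite ?subset_leq_card //.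
    by rewrite mulnC (mulnC #|B'|).
  exists a, (fun y => if y \in B' then 0%N else (b y).+1).
  exists (fun i j => if j is j'.+1 then T i j' else t); split.
  + by move=> x; apply: leq_trans (ak x) _.
  + by move=> y; case: ifP => //; rewrite ltnS bk.
  + by move=> i [].
  + move=> x y xA yB; case: ifPn => yB'; first exact: tf.
    by apply: Tf => //; rewrite inE yB'.
Qed.

(** By [expn_pred_lt], [2 ^ e * 2 ^ s] removals exhaust the rectangle; both parties announce their
    indices and run the protocol of the strip. *)
Lemma cc_le_halve (F : fieldType) (X Y : finType) (f : X -> Y -> bool) r e s D
    (A : {set X}) (B : {set Y}) :
  rank_density F f r e ->
  (forall (A' : {set X}) (B' : {set Y}), low_rank (bool_fun F f) (r + 3)./2 A' B' ->
     (#|A'| * #|B'| < 2 ^ (2 ^ s))%N -> cc_le f A' B' D) ->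
  low_rank (bool_fun F f) r A B -> (#|A| * #|B| < 2 ^ (2 ^ s))%N ->
  cc_le f A B ((e + s).+1 * 2 + D).
Proof.
move=> dens small lf ABN; have q0 : (0 < 2 ^ e)%N by rewrite expn_gt0.
have [a [b [T [ak bk TD Tf]]]] := peel dens small lf ABN (expn_pred_lt q0 ABN).
(* An index may equal the number of removals, hence the extra bit. *)
have lt_k i : (i <= 2 ^ e * 2 ^ s)%N -> (i < 2 ^ (e + s).+1)%N.
  move=> le_i; rewrite expnS expnD mul2n -addnn (leq_ltn_trans le_i) //.
  by rewrite -[X in (X < _)%N]addn0 ltn_add2l muln_gt0 !expn_gt0.
have /choice [t1 t1P] := fun i => send_bob (e + s).+1 b (TD i).
have [t [tD tE]] := send_alice (e + s).+1 a (fun i => (t1P i).1).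
exists t; split=> [|x y xA yB]; first by rewrite muln2 -addnn -addnA.
by rewrite tE ?lt_k // (t1P _).2 ?lt_k // Tf.
Qed.

Lemma rank_density_le (F : fieldType) (X Y : finType) (f : X -> Y -> bool) r r' e :
  (r <= r')%N -> rank_density F f r' e -> rank_density F f r e.
Proof. by move=> rr dens A B /(low_rank_widen rr); apply: dens. Qed.

(** The map r -> (r + 3)./2 has fixed point 3 and sends the bound [2 ^ t.+1 + 2] to [2 ^ t + 2].
    After [t] rounds the rank is at most 3, and 4 bits suffice. *)
Lemma cc_le_density (F : fieldType) (X Y : finType) (f : X -> Y -> bool) r0 e s :
  rank_density F f r0 e ->
  forall t r (A : {set X}) (B : {set Y}), (r <= 2 ^ t + 2)%N -> (r <= r0)%N ->
  low_rank (bool_fun F f) r A B -> (#|A| * #|B| < 2 ^ (2 ^ s))%N ->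
  cc_le f A B (t * ((e + s).+1 * 2) + 4).
Proof.
move=> dens; elim=> [|t IH] r A B rt rr lf ABN.
  by have [p [pD pf]] := cc_le_low_rank lf; exists p; split=> //; lia.
(* Ranks at most 3 are settled at once, because (r + 3)./2 can exceed a small [r] and hence [r0]. *)
have [r3|r_gt3] := leqP r 3.
  by have [p [pD pf]] := cc_le_low_rank lf; exists p; split=> //; lia.
rewrite mulSn -addnA; apply: cc_le_halve lf ABN.
  exact: rank_density_le dens.
move=> A' B' lf'; apply: IH lf'; move: rt rr; rewrite ?expnS; lia.
Qed.

(** Merging equal rows and equal columns leaves at most 2^rank of each, so the size is below
    [2 ^ (2 ^ t.+1)] whatever [X] and [Y] are. *)
Lemma CCdet_density (R : realType) (X Y : finType) (f : X -> Y -> bool) e t :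
  (frank R f + 3 <= 2 ^ t)%N -> rank_density R f (frank R f) e ->
  (CCdet f <= t * ((e + t.+1).+1 * 2) + 4)%N.
Proof.
move=> rt dens; have lf := low_rank_frank R f.
have [A [rho [cA rhoP]]] := low_rank_repr lf.
have [B [sigma [cB sigmaP]]] := low_rank_repr (low_rank_tr lf).
apply: CCdet_le; apply: (@cc_le_repr X Y f _ A _ B rho sigma).
- by move=> x xX; have [] := rhoP x xX.
- by move=> y yY; have [] := sigmaP y yY.
- by move=> x y xX yY; rewrite (rhoP x xX).2 ?inE // (sigmaP y yY).2 ?inE.
apply: (cc_le_density dens _ (leqnn _)); first by lia.
  exact: low_rankS (finset.subsetT _) (finset.subsetT _) lf.
apply: leq_ltn_trans (leq_mul cA cB) _; rewrite -expnD ltn_exp2l //.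
by rewrite expnS; lia.
Qed.

(** * Counting, and monochromatic rectangles from protocols *)

Lemma card_set_count (T : finType) (A : {set T}) (p : pred T) :
  #|[set x in A | p x]| = count p (enum A).
Proof.
rewrite cardE -size_filter; apply/perm_size/uniq_perm.
- exact: enum_uniq.
- exact/filter_uniq/enum_uniq.
- by move=> x; rewrite mem_enum mem_filter mem_enum inE andbC.
Qed.

Lemma count_card_nth (T : Type) (x0 : T) (a : pred T) (s : seq T) :
  count a s = #|[set i : 'I_(size s) | a (nth x0 s i)]|.
Proof.
have -> : [set i : 'I_(size s) | a (nth x0 s i)]
        = [set i in [set: 'I_(size s)] | a (nth x0 s i)].
  by apply/setP => i; rewrite !inE.
rewrite card_set_count -{1}[s](mkseq_nth x0) /mkseq count_map.
by rewrite -val_enum_ord count_map; congr count; rewrite enum_setT -enumT.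
Qed.

(** Following the larger side at every node loses at most a factor 2 per bit. *)
Lemma protocol_rectangle (X Y : finType) (t : protocol X Y) (A : {set X}) (B : {set Y}) :
  exists (A' : {set X}) (B' : {set Y}) (b : bool),
    [/\ A' \subset A, B' \subset B, {in A' & B', forall x y, peval t x y = b} &
        (#|A| * #|B| <= 2 ^ pdepth t * (#|A'| * #|B'|))%N].
Proof.
have grow d d' m a a' : (a <= a'.*2)%N -> (a' <= 2 ^ d * m)%N -> (d <= d')%N ->
    (a <= 2 ^ d'.+1 * m)%N.
  move=> le_a le_a' dd'; apply: leq_trans le_a _.
  have : (2 ^ d * m <= 2 ^ d' * m)%N by rewrite leq_mul2r leq_exp2l ?dd' ?orbT.
  by rewrite expnS; lia.
elim: t A B => [b|g t0 IH0 t1 IH1|g t0 IH0 t1 IH1] A B /=.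
- by exists A, B, b; split=> //; rewrite mul1n.
- have cA := cardsID [set x | g x] A.
  have [le01|/ltnW le10] := leqP #|A :\: [set x | g x]| #|A :&: [set x | g x]|.
  + have [A' [B' [b [sA sB tb dens]]]] := IH1 (A :&: [set x | g x]) B.
    exists A', B', b; split=> //.
    * exact: fintype.subset_trans sA (finset.subsetIl _ _).
    * move=> x y xA yB; have := fintype.subsetP sA x xA.
      by rewrite !inE => /andP [_ ->]; apply: tb.
    * by apply: grow dens (leq_maxr _ _); rewrite -cA; nia.
  + have [A' [B' [b [sA sB tb dens]]]] := IH0 (A :\: [set x | g x]) B.
    exists A', B', b; split=> //.
    * exact: fintype.subset_trans sA (finset.subsetDl _ _).
    * move=> x y xA yB; have := fintype.subsetP sA x xA.
      by rewrite !inE => /andP [/negPf -> _]; apply: tb.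
    * by apply: grow dens (leq_maxl _ _); rewrite -cA; nia.
- have cB := cardsID [set y | g y] B.
  have [le01|/ltnW le10] := leqP #|B :\: [set y | g y]| #|B :&: [set y | g y]|.
  + have [A' [B' [b [sA sB tb dens]]]] := IH1 A (B :&: [set y | g y]).
    exists A', B', b; split=> //.
    * exact: fintype.subset_trans sB (finset.subsetIl _ _).
    * move=> x y xA yB; have := fintype.subsetP sB y yB.
      by rewrite !inE => /andP [_ ->]; apply: tb.
    * by apply: grow dens (leq_maxr _ _); rewrite -cB; nia.
  + have [A' [B' [b [sA sB tb dens]]]] := IH0 A (B :\: [set y | g y]).
    exists A', B', b; split=> //.
    * exact: fintype.subset_trans sB (finset.subsetDl _ _).
    * move=> x y xA yB; have := fintype.subsetP sB y yB.
      by rewrite !inE => /andP [/negPf -> _]; apply: tb.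
    * by apply: grow dens (leq_maxl _ _); rewrite -cB; nia.
Qed.

(** A product is nonzero exactly when both factors are. This serves the ranks below 2, about which
    (A) says nothing. *)
Lemma cc_le_low_rank1 (F : fieldType) (X Y : finType) (f : X -> Y -> bool)
    (A : {set X}) (B : {set Y}) :
  low_rank (bool_fun F f) 1 A B -> cc_le f A B 2.
Proof.
move=> [u [v uv]].
exists (PAlice (fun x => u x 0%N != 0) (PLeaf X Y false)
         (PBob (fun y => v y 0%N != 0) (PLeaf X Y false) (PLeaf X Y true))).
split=> // x y xA yB /=; have := uv x y xA yB; rewrite big_ord1 /bool_fun.
case: (eqVneq (u x 0%N) 0) => [->|u0]; last case: (eqVneq (v y 0%N) 0) => [->|v0].
- by rewrite mul0r; case: (f x y) => //= /eqP; rewrite oner_eq0.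
- by rewrite mulr0; case: (f x y) => //= /eqP; rewrite oner_eq0.
- case: (f x y) => //= /esym/eqP.
  by rewrite mulf_eq0 (negPf u0) (negPf v0).
Qed.

(** * From configurations to 0/1 matrices *)

Lemma rs_value_le (R : realType) d (P : seq 'rV[R]_d) (H : seq (hyp R d)) x0 V :
  (rs_value P H x0 V <= rs P H)%N.
Proof.
by rewrite /rs; case: ex_maxnP => m _; apply; apply/asboolP; exists x0, V.
Qed.

Lemma rs_attained (R : realType) d (P : seq 'rV[R]_d) (H : seq (hyp R d)) :
  exists x0 V, rs_value P H x0 V = rs P H.
Proof. by rewrite /rs; case: ex_maxnP => m /asboolP. Qed.

Lemma dotpD (R : realType) d (a x y : 'rV[R]_d) : dotp a (x + y) = dotp a x + dotp a y.
Proof. by rewrite /dotp -big_split; apply: eq_bigr => i _; rewrite mxE mulrDr. Qed.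

Lemma dotpZ (R : realType) d (a x : 'rV[R]_d) c : dotp a (c *: x) = c * dotp a x.
Proof. by rewrite /dotp big_distrr; apply: eq_bigr => i _; rewrite mxE mulrCA. Qed.

Lemma dotp_span0 (R : realType) d (a x : 'rV[R]_d) (s : seq 'rV[R]_d) :
  {in s, forall w, dotp a w = 0} -> x \in <<s>>%VS -> dotp a x = 0.
Proof.
move=> s0 /(@coord_span _ _ _ (in_tuple s)) ->.
elim/big_rec: _ => [|i w _ IH].
  by rewrite /dotp big1 // => i _; rewrite mxE mulr0.
by rewrite dotpD dotpZ IH s0 ?mulr0 ?addr0 // mem_nth.
Qed.

Lemma count_has_flatten (T : Type) (a : pred T) (Q : seq (seq T)) :
  (count (has a) Q <= count a (flatten Q))%N.
Proof.
elim: Q => //= s Q IH; rewrite count_cat leq_add // has_count.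
by case: (count a s).
Qed.

Lemma size_flatten_le (T : eqType) k (Q : seq (seq T)) :
  {in Q, forall s, (size s <= k)%N} -> (size (flatten Q) <= k * size Q)%N.
Proof.
elim: Q => [|s Q IH] Qk /=; first by rewrite muln0.
rewrite size_cat mulnS leq_add ?Qk ?mem_head // IH // => s' s'Q.
by apply: Qk; rewrite in_cons s'Q orbT.
Qed.

(** The matrix pairs points with blocks, its entries being inner products with the common normal of
    the block. The exponent gains 1 because a block holds up to two hyperplanes. *)
Lemma rs_ge_CCdet (R : realType) d (P : seq 'rV[R]_d) (H : seq (hyp R d)) :
  has_parallel_partition 2 P H ->
  {in H, forall h, h.2 = 0 \/ h.2 = 1} ->
  exists (X Y : finType) (f : X -> Y -> bool), low_rank (bool_fun R f) d [set: X] [set: Y] /\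
    (size H * size P <= 2 ^ (CCdet f).+1 * rs P H)%N.
Proof.
move=> [Q [permQ blkP]] H01.
pose normal blk : 'rV[R]_d := (head (0, 0) blk : hyp R d).1.
have normalE blk h : blk \in Q -> h \in blk -> h.1 = normal blk.
  move=> bQ hb; have [b0 _ par _] := blkP _ bQ.
  by apply: par => //; case: (blk) b0 => //= ? ? _; rewrite mem_head.
(* The point lies on a hyperplane of the block, whose offset is 0 or 1. *)
have normal01 blk p : blk \in Q -> p \in P ->
    dotp (normal blk) p = ((dotp (normal blk) p == 1) : nat)%:R.
  move=> bQ pP; have [_ _ _ /(_ p pP) [h hb ph]] := blkP _ bQ.
  have hH : h \in H by rewrite -(perm_mem permQ); apply/flattenP; exists blk.
  rewrite -(normalE _ _ bQ hb) ph; case: (H01 _ hH) => ->; last by rewrite eqxx.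
  by rewrite eq_sym oner_eq0.
pose f (i : 'I_(size P)) (j : 'I_(size Q)) :=
  dotp (normal (nth [::] Q j)) (nth 0 P i) == 1.
have fE (i : 'I__) (j : 'I__) : dotp (normal (nth [::] Q j)) (nth 0 P i) = (f i j : nat)%:R.
  by rewrite /f -normal01 ?mem_nth.
exists 'I_(size P), 'I_(size Q), f; split.
  apply/low_rank_mxP; exists (fun i : 'I_(size P) => nth 0 P i), (fun j : 'I_(size Q) => (normal (nth [::] Q j))^T).
  move=> i j _ _; rewrite /bool_fun -fE /dotp !mxE.
  by apply: eq_bigr => k _; rewrite !mxE mulrC.
have [t [tf td]] := CCdet_protocol f.
have [A [B [b [_ _ tb]]]] := protocol_rectangle t [set: 'I_(size P)] [set: 'I_(size Q)].
rewrite !cardsT !card_ord => dens.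
have sH : (size H <= 2 * size Q)%N.
  rewrite -(perm_size permQ); apply: size_flatten_le => blk bQ.
  by have [] := blkP _ bQ.
suff AB_rs : (#|A| * #|B| <= rs P H)%N.
  have le1 : (2 ^ pdepth t * (#|A| * #|B|) <= 2 ^ CCdet f * rs P H)%N.
    by rewrite leq_mul // leq_exp2l.
  have le2 : (size H * size P <= 2 * size Q * size P)%N by rewrite leq_mul2r sH orbT.
  apply: leq_trans le2 _; rewrite expnS -!mulnA leq_mul2l /= mulnC.
  exact: leq_trans dens le1.
have [->|[i0 i0A]] := set_0Vmem A; first by rewrite cards0.
pose x0 : 'rV[R]_d := nth 0 P i0.
(* The direction space of the affine hull of the points in [A], based at [x0]. *)
pose V : {vspace 'rV[R]_d} := <<[seq (nth 0 P (i : 'I__) - x0)%R | i <- enum A]>>%VS.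
apply: leq_trans (rs_value_le P H x0 V); rewrite /rs_value leq_mul //.
  rewrite (count_card_nth 0) subset_leq_card //; apply/fintype.subsetP => i iA.
  rewrite inE /in_aff memv_span //; apply/mapP; exists i => //.
  by rewrite mem_enum.
(* Each block indexed by [B] contributes at least one hyperplane, namely the one through [x0]. *)
rewrite -(permP permQ) (leq_trans _ (count_has_flatten _ _)) //.
rewrite (count_card_nth [::]) subset_leq_card //; apply/fintype.subsetP => j jB.
have jQ : nth [::] Q j \in Q by rewrite mem_nth.
have [_ _ _ /(_ x0 (mem_nth 0 (ltn_ord i0))) [h hb hx0]] := blkP _ jQ.
rewrite inE; apply/hasP; exists h => //; apply/asboolP => y yV.
(* The matrix is constant on [A] in column [j], so the normal of the block is orthogonal to [V]. *)
rewrite /on_hyp -hx0 -(subrK x0 y) dotpD -[RHS]add0r; congr (_ + _).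
apply: dotp_span0 yV => w /mapP [i]; rewrite mem_enum => iA ->.
rewrite -scaleN1r dotpD dotpZ (normalE _ _ jQ hb) !fE -!tf !tb //.
by rewrite mulN1r subrr.
Qed.

(** * From rank factorizations to configurations *)

Definition ext3 (R : realType) r (w : nat -> R) (a b c : R) : 'rV[R]_(r.+3) :=
  \row_(i < r.+3) if (i < r)%N then w i else nth 0 [:: a; b; c] (i - r).
Arguments ext3 {R} r w a b c.

Lemma dotp_ext3 (R : realType) r (w w' : nat -> R) a b c a' b' c' :
  dotp (ext3 r w a b c) (ext3 r w' a' b' c') =
  \sum_(i < r) w i * w' i + a * a' + b * b' + c * c'.
Proof.
have [l0 l1 l2] : [/\ (r < r = false)%N, (r.+1 < r = false)%N & (r.+2 < r = false)%N].
  by split; lia.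
have [e0 e1 e2] : [/\ (r - r = 0)%N, (r.+1 - r = 1)%N & (r.+2 - r = 2)%N].
  by split; lia.
rewrite /dotp !big_ord_recr !mxE /= l0 l1 l2 e0 e1 e2 /=; congr (_ + _ + _ + _).
by apply: eq_bigr => i _; rewrite !mxE /= ltn_ord.
Qed.

Lemma count_offset_pairs (T N O : Type) (g : T -> N) (b0 b1 : O) (a : pred (N * O))
    (s : seq T) :
  count a [seq (g y, b) | y <- s, b <- [:: b0; b1]] =
  (count (fun y => a (g y, b0)) s + count (fun y => a (g y, b1)) s)%N.
Proof. by elim: s => //= y s ->; lia. Qed.

(* The last three coordinates separate points and hyperplanes that may coincide
   in the rank factorization (equal rows, equal or zero columns) without
   changing any inner product. *)
Lemma rank_density_rs (R : realType) (X Y : finType) (f : X -> Y -> bool) r e :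
  (forall (P : seq 'rV[R]_(r.+3)) (H : seq (hyp R r.+3)),
     configuration P H -> has_parallel_partition 2 P H ->
     offsets_are H [set b | b = 0 \/ b = 1] ->
     (size H * size P <= 2 ^ e * rs P H)%N) ->
  rank_density R f r e.
Proof.
move=> rsB A B [u [v uv]].
(* An empty [B] would give no hyperplanes, and the offset set would not be {0, 1}. *)
have [B0|[y0 y0B]] := set_0Vmem B.
  exists A, B, false; split=> //; last by rewrite B0 cards0 muln0.
  by move=> x y _; rewrite B0 inE.
pose pt x := ext3 r (u x) (enum_rank x : nat)%:R 0 0.
pose nr y := ext3 r (v y) 0 1 (enum_rank y : nat)%:R.
have nr_pt x y : x \in A -> y \in B -> dotp (nr y) (pt x) = bool_fun R f x y.
  move=> xA yB; rewrite dotp_ext3 uv // mul0r !mulr0 !addr0.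
  by apply: eq_bigr => i _; rewrite mulrC.
have pt_inj : injective pt.
  move=> x x' /(congr1 (dotp (ext3 r (fun=> 0) 1 0 0))); rewrite !dotp_ext3.
  rewrite !mul0r !mul1r !addr0 !big1 ?add0r; try by move=> i _; rewrite mul0r.
  by move/eqP; rewrite eqr_nat => /eqP /val_inj /enum_rank_inj.
have nr_test y b c : dotp (nr y) (ext3 r (fun=> 0) 0 b c) = b + (enum_rank y : nat)%:R * c.
  by rewrite dotp_ext3 big1 ?mul0r ?mul1r ?add0r // => i _; rewrite mulr0.
(* Two test points separate the hyperplanes: one has inner product [b] with every normal and reveals
   the offset; the other, on the hyperplane of [y], lies on that of [y'] only if the labels
   agree. *)
have hyp_inj y y' b b' : hyp_set (nr y, b) = hyp_set (nr y', b') -> y = y' /\ b = b'.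
  move=> E; have iffE z : dotp (nr y) z = b <-> dotp (nr y') z = b'.
    by have /(congr1 (fun S => S z)) := E; rewrite /hyp_set /on_hyp /= => ->.
  have bb' : b = b'.
    by have := (iffE (ext3 r (fun=> 0) 0 b 0)).1; rewrite !nr_test !mulr0 !addr0; apply.
  split=> //; have := (iffE (ext3 r (fun=> 0) 0 (b + (enum_rank y : nat)%:R) (- 1))).1.
  rewrite !nr_test mulrN1 addrK -bb' => /(_ erefl) /eqP.
  rewrite mulrN1 -addrA -[X in _ == X]addr0 (inj_eq (addrI b)) subr_eq0 eqr_nat => /eqP.
  by move=> /val_inj /enum_rank_inj.
pose P := [seq pt x | x <- enum A].
pose H : seq (hyp R r.+3) := [seq (nr y, b) | y <- enum B, b <- [:: 0; 1]].
have HP h : h \in H -> exists y b, [/\ y \in B, b = 0 \/ b = 1 & h = (nr y, b)].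
  case/allpairsP => [[y b]] /= [yB b01 ->]; exists y, b; split=> //.
    by rewrite mem_enum in yB.
  by move: b01; rewrite !inE => /orP [] /eqP; [left|right].
have conf : configuration P H.
  split.
  - by rewrite map_inj_uniq ?enum_uniq.
  - apply: allpairs_uniq; rewrite ?enum_uniq //=.
      by rewrite inE eq_sym oner_eq0.
    move=> [y b] [y' b'] _ _ /= [/(congr1 (fun a => hyp_set (a, b)))].
    by move=> /hyp_inj [-> _] ->.
  - move=> h /HP [y [b [_ _ ->]]] /=; apply/eqP => nr0.
    have := nr_test y 1 0; rewrite nr0 mulr0 addr0 /dotp big1 => [|i _].
      by move/eqP; rewrite eq_sym oner_eq0.
    by rewrite mxE mul0r.
  - by move=> h h' /HP [y [b [_ _ ->]]] /HP [y' [b' [_ _ ->]]] /hyp_inj [-> ->].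
have part : has_parallel_partition 2 P H.
  exists [seq [seq (nr y, b) | b <- [:: 0; 1]] | y <- enum B]; split=> //.
  move=> blk /mapP [y]; rewrite mem_enum => yB ->; split=> //.
    by move=> h h'; rewrite !inE => /orP [] /eqP -> /orP [] /eqP ->.
  move=> p /mapP [x]; rewrite mem_enum => xA ->.
  exists (nr y, bool_fun R f x y); last exact: nr_pt.
  by rewrite /bool_fun !inE; case: (f x y); rewrite eqxx ?orbT.
have offs : offsets_are H [set b | b = 0 \/ b = 1].
  move=> b; split=> [/mapP [h /HP [y [b' [_ b01 ->]]] ->] //|b01].
  apply/mapP; exists (nr y0, b) => //; apply/allpairsP; exists (y0, b) => /=.
  by split; rewrite ?mem_enum // !inE; case: b01 => ->; rewrite eqxx ?orbT.
have := rsB P H conf part offs; have [x0 [V <-]] := rs_attained P H.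
rewrite /rs_value size_allpairs size_map -!cardE /= count_map count_offset_pairs.
rewrite -!card_set_count.
set A' := [set x in A | _]; pose B' (b : bool) :=
  [set y in B | `[< aff_sub_hyp x0 V (nr y, (b : nat)%:R) >]].
rewrite -/(B' false) -/(B' true) => dens.
have mono b : {in A' & B' b, forall x y, f x y = b}.
  move=> x y; rewrite !inE => /andP [xA xV] /andP [yB /asboolP yV].
  by apply: (@bool_fun_inj R); rewrite -/(bool_fun R f x y) -nr_pt //; apply: yV.
have sA : A' \subset A by apply/fintype.subsetP => x; rewrite inE => /andP [].
have sB b : B' b \subset B by apply/fintype.subsetP => y; rewrite inE => /andP [].
(* Keeping the more frequent offset costs a factor 2, which is regained because there are two
   hyperplanes per element of [B]. *)
have half m m' n : (n <= m)%N ->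
    (#|B| * 2 * #|A| <= 2 ^ e * (#|A'| * m'))%N -> m' = (n + m)%N ->
    (#|A| * #|B| <= 2 ^ e * (#|A'| * m))%N.
  move=> nm + m'E; rewrite m'E !mulnDr mulnAC [(#|B| * _)%N]mulnC.
  have : (2 ^ e * (#|A'| * n) <= 2 ^ e * (#|A'| * m))%N by rewrite !leq_mul2l nm !orbT.
  lia.
have [le01|/ltnW le10] := leqP #|B' false| #|B' true|.
  by exists A', (B' true), true; split=> //; apply: half le01 dens _.
by exists A', (B' false), false; split=> //; apply: half le10 dens (addnC _ _).
Qed.

(** * Polylogarithmic estimates *)

Lemma ler_log2 (R : realType) (m n : nat) : (0 < m)%N -> (m <= n)%N ->
  log2 (m%:R : R) <= log2 n%:R.
Proof.
move=> m0 mn; rewrite /log2 ler_wpM2r ?invr_ge0 ?ln_ge0 ?ler1n //.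
by rewrite ler_ln ?posrE ?ltr0n ?ler_nat // (leq_trans m0).
Qed.

Lemma log2X (R : realType) (m k : nat) : (0 < m)%N ->
  log2 ((m ^ k)%:R : R) = k%:R * log2 m%:R.
Proof. by move=> m0; rewrite /log2 natrX lnXn ?ltr0n // mulrA mulr_natl. Qed.

Lemma log2_exp2 (R : realType) (k : nat) : log2 ((2 ^ k)%:R : R) = k%:R.
Proof.
rewrite log2X // /log2 divff ?mulr1 //.
by rewrite gt_eqF // ln_gt0 // ltr1n.
Qed.

Lemma log2_ge1 (R : realType) (n : nat) : (2 <= n)%N -> 1 <= log2 (n%:R : R).
Proof.
by move=> n2; have e := log2_exp2 R 1; rewrite -[leLHS]e; apply: ler_log2.
Qed.

Lemma powR_ge1 (R : realType) (x a : R) : 1 <= x -> 0 <= a -> 1 <= x `^ a.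
Proof. by move=> x1 a0; have := ler_powR x1 a0; rewrite powRr0. Qed.

(** [C] may be negative, so the factor is raised first, then the exponent, then the base. *)
Lemma ler_polylog (R : realType) (C C' x y : R) :
  C <= C' -> 0 <= C' -> 1 <= x -> x <= y -> C * x `^ C <= C' * y `^ C'.
Proof.
move=> CC' C'0 x1 xy; have x0 : 0 <= x by apply: le_trans x1.
apply: (le_trans (ler_wpM2r (powR_ge0 _ _) CC')); apply: ler_wpM2l => //.
apply: (le_trans (ler_powR x1 CC')); apply: ge0_ler_powR => //.
by rewrite nnegrE (le_trans x0).
Qed.

(** With l the logarithm of the rank and K = C 3^C, there are t <= 4 l rounds of cost at most 2 (K +
    7) l^C. The total is at most (8 K + 60) l^(1 + C), and the same number serves as exponent since
    it exceeds 1 + C. *)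
Lemma CCdet_polylog (R : realType) (X Y : finType) (f : X -> Y -> bool) (C : R) (e : nat) :
  1 <= C -> (2 <= frank R f)%N -> rank_density R f (frank R f) e ->
  e%:R <= C * log2 (frank R f + 3)%:R `^ C + 1 ->
  (CCdet f)%:R <=
  (8 * (C * 3 `^ C) + 60) * log2 (frank R f)%:R `^ (8 * (C * 3 `^ C) + 60).
Proof.
set M := 8 * _ + 60 => C1 r2 dens le_e; have CC t := @CCdet_density R _ _ f e t ^~ dens.
move: (frank R f) r2 le_e CC => r r2 le_e CC {dens}.
set l := log2 r%:R; set L := log2 _ in le_e.
have C0 : 0 <= C by apply: le_trans C1.
have l1 : 1 <= l by apply: log2_ge1.
have l0 : 0 <= l by apply: le_trans l1.
(* For r >= 2 one has r + 3 <= r^3. *)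
have Ll : L <= 3 * l.
  rewrite -[3]/(3%:R) -log2X ?(ltnW r2) //; apply: ler_log2; first by lia.
  rewrite !expnS expn0 muln1; have := leq_mul r2 (leq_mul r2 (leqnn r)); lia.
have L1 : 1 <= L by apply: log2_ge1; lia.
have [t tL rt] : exists2 t : nat, t%:R <= L + 1 & (r + 3 <= 2 ^ t)%N.
  exists (up_log 2 (r + 3)); last exact: up_logP.
  have t0 : (0 < up_log 2 (r + 3))%N by rewrite up_log_gt0; lia.
  rewrite -(prednK t0) -addn1 natrD lerD2r -(log2_exp2 R) ler_log2 ?expn_gt0 //.
  by apply/ltnW/up_log_gtn; lia.
pose p := l `^ C; pose K := C * 3 `^ C.
have lp : l <= p by apply: le1r_powR.
have LK : C * L `^ C <= K * p.
  rewrite /K /p -mulrA -powRM // ler_wpM2l // ge0_ler_powR // nnegrE.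
    exact: le_trans L1.
  by rewrite mulr_ge0.
have CK : C <= K.
  by rewrite /K ler_peMr // powR_ge1 // ler1n.
have tl : t%:R <= 4 * l by lra.
have ep : e%:R + t%:R + 2 <= (K + 7) * p.
  by rewrite mulrDl; lra.
have CCb : (CCdet f)%:R <= t%:R * ((e%:R + t%:R + 2) * 2) + 4 :> R.
  have := CC t rt; rewrite -(ler_nat R) => /le_trans; apply.
  have -> : ((e + t.+1).+1 = e + t + 2)%N by lia.
  by rewrite !(natrD, natrM).
apply: (le_trans CCb).
have K0 : 0 <= K by apply: le_trans CK.
have p1 : 1 <= p by apply: le_trans lp.
have step : t%:R * ((e%:R + t%:R + 2) * 2) <= (4 * l) * ((K + 7) * p * 2).
  apply: ler_pM => //; last by rewrite ler_pM2r.
  by rewrite mulr_ge0 // !addr_ge0.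
have lpM : l * p <= l `^ M.
  have -> : l * p = l `^ (1 + C).
    by rewrite powRD ?powRr1 //; apply/implyP => _; rewrite gt_eqF // (lt_le_trans _ l1).
  by apply: ler_powR => //; rewrite /M -/K; lra.
have lp1 : 1 <= l * p by rewrite -[1]mulr1 ler_pM.
have MK : M = 8 * K + 60 by [].
apply: (@le_trans _ _ (M * (l * p))); last by rewrite ler_wpM2l // MK; lra.
have -> : M * (l * p) = 4 * l * ((K + 7) * p * 2) + 4 * (l * p) by rewrite MK; ring.
by apply: lerD => //; lra.
Qed.

(** * The two implications and their constants *)

Unset Implicit Arguments.

Theorem theorem2p5 (R : realType) :
  (exists C : R, forall (X Y : finType) (f : X -> Y -> bool),
      (2 <= frank R f)%N ->
      (CCdet f)%:R <= C * (log2 (frank R f)%:R) `^ C)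
  <->
  (exists C : R, forall (d : nat), (2 <= d)%N ->
      forall (P : seq 'rV[R]_d) (H : seq (hyp R d)),
        configuration P H ->
        has_parallel_partition 2 P H ->
        offsets_are H [set b | b = 0 \/ b = 1] ->
        (size H * size P)%:R * 2 `^ (- (C * (log2 d%:R) `^ C)) <= (rs P H)%:R).
Proof.
split=> [[C CC_le]|[C rs_ge]].
(* The absolute value guards against a negative [C]; the 3 pays for the bit lost to the block size
   and, for ranks below 2, also for the two-bit protocol. *)
- exists (`|C| + 3) => d d2 P H _ part offs; set C' := `|C| + 3.
  have H01 : {in H, forall h, h.2 = 0 \/ h.2 = 1}.
    by move=> h hH; apply/offs; apply: map_f.
  have [X [Y [f [lf le_rs]]]] := rs_ge_CCdet part H01.
  have ld1 : 1 <= log2 (d%:R : R) by apply: log2_ge1.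
  have absC : 0 <= `|C| by [].
  have q1 : 1 <= log2 (d%:R : R) `^ C' by apply: powR_ge1 => //; apply: addr_ge0.
  have CCb : (CCdet f).+1%:R <= C' * log2 (d%:R : R) `^ C'.
    rewrite -addn1 natrD; have [r2|r1] := leqP 2 (frank R f).
      have fd := frank_le lf.
      apply: (@le_trans _ _ (`|C| * log2 d%:R `^ `|C| + 1)).
        rewrite lerD2r (le_trans (CC_le _ _ _ r2)) // ler_polylog ?ler_norm //.
          exact: log2_ge1.
        by apply: ler_log2 => //; lia.
      have le1 : `|C| * log2 d%:R `^ `|C| <= `|C| * log2 (d%:R : R) `^ C'.
        by rewrite ler_wpM2l // ler_powR // lerDl.
      rewrite mulrDl; lra.
    have /CCdet_le : cc_le f [set: X] [set: Y] 2.
      apply: (@cc_le_low_rank1 R); apply: low_rank_widen (low_rank_frank R f).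
      by rewrite -ltnS.
    rewrite -(ler_nat R) => cc2.
    have le3 : 3 * 1 <= C' * log2 (d%:R : R) `^ C'.
      by apply: ler_pM => //; rewrite lerDr.
    lra.
  rewrite powRN ler_pdivrMr ?powR_gt0 //.
  apply: (@le_trans _ _ ((2 ^ (CCdet f).+1 * rs P H)%:R)); first by rewrite ler_nat.
  rewrite natrM mulrC ler_wpM2l // natrX -powR_mulrn // ler_powR // ler1n //.
(* [CCdet_polylog] asks for a constant that is at least 1. *)
- pose C1 := `|C| + 1; have C11 : 1 <= C1 by rewrite lerDr.
  exists (8 * (C1 * 3 `^ C1) + 60) => X Y f r2.
  set x := C1 * log2 (frank R f + 3)%:R `^ C1.
  have x0 : 0 <= x by rewrite mulr_ge0 ?powR_ge0 // (le_trans _ C11).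
  (* The exponent from (B) in dimension rank + 3 is at most [x]; [e] is an integer between [x] and
     [x + 1]. *)
  apply: (CCdet_polylog (e := (Num.truncn x).+1)) => //; last first.
    by rewrite -addn1 natrD lerD2r truncn_le.
  apply: rank_density_rs => P H conf part offs.
  have := rs_ge _ (isT : (2 <= (frank R f).+3)%N) P H conf part offs.
  rewrite powRN ler_pdivrMr ?powR_gt0 // -(ler_nat R) => /le_trans; apply.
  rewrite natrM mulrC ler_wpM2r // natrX -powR_mulrn // ler_powR ?ler1n //.
  apply: (@le_trans _ _ x); last by apply/ltW; have /andP [] := truncn_itv x0.
  rewrite /x addn3; apply: ler_polylog => //; last by apply: log2_ge1.
    by rewrite (le_trans (ler_norm _)) // lerDl.
  exact: le_trans C11.
Qed.
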